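(* Let $\mathcal{I}$ be a proper right tensor ideal in a pivotal tensor category $\mathcal{C}$ over an algebraically closed field $k$. Then the right categorical trace of $\mathcal{C}$ vanishes identically on $\mathcal{I}$: for every $X\in\mathcal{I}$ and every $f\in\mathrm{End}_{\mathcal{C}}(X)$ one has $$\mathrm{tr}^{\mathcal{C}}_X(f)=\widetilde{\mathrm{ev}}_X\circ(f\otimes\mathrm{id}_{X^\vee})\circ\mathrm{coev}_X=0 .$$
   Context: A tensor category over $k$ is a $k$-linear abelian category which is locally finite (finite-dimensional Hom-spaces, every object has finite length), monoidal with bilinear tensor product $\otimes$ and simple tensor unit $\mathbf{1}$, and rigid. A pivotal structure is a monoidal natural isomorphism $\delta:\mathrm{id}_{\mathcal{C}}\Rightarrow(-)^{\vee\vee}$, where $X^\vee$ is the left dual with maps $\mathrm{ev}_X:X^\vee\otimes X\to\mathbf{1}$, $\mathrm{coev}_X:\mathbf{1}\to X\otimes X^\vee$; set $\widetilde{\mathrm{ev}}_X=\mathrm{ev}_{X^\vee}\circ(\delta_X\otimes\mathrm{id}_{X^\vee}):X\otimes X^\vee\to\mathbf{1}$. A right tensor ideal $\mathcal{I}$ of $\mathcal{C}$ is a full subcategory such that $X\otimes V\in\mathcal{I}$ for all $X\in\mathcal{I}$, $V\in\mathcal{C}$, and which is closed under retracts (if $Z\in\mathcal{I}$ and $Z\cong X\oplus Y$ then $X,Y\in\mathcal{I}$). It is proper if $\mathcal{I}\neq\mathcal{C}$. *)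

(* Defs.v *)
From HB Require Import structures.
From mathcomp Require Import all_boot all_order all_algebra.

Set Implicit Arguments.
Unset Strict Implicit.
Unset Printing Implicit Defensive.

Import GRing.Theory.
Local Open Scope ring_scope.

Declare Scope cat_scope.
Delimit Scope cat_scope with cat.
Local Open Scope cat_scope.

(* Finite-dimensionality of the Hom-spaces is carried by [vectType k]. *)
Record linearCategory (k : fieldType) := LinearCategory {
  ob :> Type;
  mor : ob -> ob -> vectType k;
  idm : forall X, mor X X;
  compm : forall X Y Z, mor Y Z -> mor X Y -> mor X Z;
  comp1m : forall X Y (f : mor X Y), compm (idm Y) f = f;
  compm1 : forall X Y (f : mor X Y), compm f (idm X) = f;
  compA : forall W X Y Z (h : mor Y Z) (g : mor X Y) (f : mor W X),
    compm h (compm g f) = compm (compm h g) f;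
  comp_linear_r : forall X Y Z (g : mor Y Z), linear (@compm X Y Z g);
  comp_linear_l : forall X Y Z (f : mor X Y), linear ((@compm X Y Z)^~ f)
}.

Arguments mor {k l} X Y.
Arguments idm {k l} X.
Arguments compm {k l X Y Z} g f.

Notation "g ∘ f" := (compm g f)
  (at level 40, left associativity) : cat_scope.

Section Abelian.
Variables (k : fieldType) (C : linearCategory k).
Implicit Types X Y Z : C.

Definition is_iso X Y (f : mor X Y) : Prop :=
  exists g : mor Y X, g ∘ f = idm X /\ f ∘ g = idm Y.

Definition isomorphic X Y : Prop := exists f : mor X Y, is_iso f.

Definition is_mono X Y (f : mor X Y) : Prop :=
  forall W (g h : mor W X), f ∘ g = f ∘ h -> g = h.

Definition is_epi X Y (f : mor X Y) : Prop :=
  forall Z (g h : mor Y Z), g ∘ f = h ∘ f -> g = h.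

(* Hom-sets always contain 0, so this says: both initial and terminal. *)
Definition is_zero X : Prop :=
  (forall Y (f : mor X Y), f = 0) /\ (forall Y (f : mor Y X), f = 0).

Definition is_kernel K X Y (i : mor K X) (f : mor X Y) : Prop :=
  f ∘ i = 0 /\
  (forall W (g : mor W X), f ∘ g = 0 -> exists! h : mor W K, i ∘ h = g).

Definition is_cokernel X Y Q (p : mor Y Q) (f : mor X Y) : Prop :=
  p ∘ f = 0 /\
  (forall Z (g : mor Y Z), g ∘ f = 0 -> exists! h : mor Q Z, h ∘ p = g).

Definition is_direct_sum X Y S : Prop :=
  exists (i1 : mor X S) (i2 : mor Y S) (p1 : mor S X) (p2 : mor S Y),
    [/\ p1 ∘ i1 = idm X, p2 ∘ i2 = idm Y, p1 ∘ i2 = 0, p2 ∘ i1 = 0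
      & i1 ∘ p1 + i2 ∘ p2 = idm S].

Record is_abelian : Prop := Abelian {
  abelian_zero : exists Z : C, is_zero Z;
  abelian_sum : forall X Y, exists S, is_direct_sum X Y S;
  abelian_ker : forall X Y (f : mor X Y),
    exists K (i : mor K X), is_kernel i f;
  abelian_coker : forall X Y (f : mor X Y),
    exists Q (p : mor Y Q), is_cokernel p f;
  abelian_mono : forall X Y (i : mor X Y), is_mono i ->
    exists Z (f : mor Y Z), is_kernel i f;
  abelian_epi : forall X Y (p : mor X Y), is_epi p ->
    exists Z (f : mor Z X), is_cokernel p f
}.

Definition is_simple X : Prop :=
  ~ is_zero X /\
  (forall Y (i : mor Y X), is_mono i -> is_zero Y \/ is_iso i).

(* Existence of a finite composition series, built from the bottom up by
   short exact sequences 0 -> Y -> X -> S -> 0 with S simple. *)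
Inductive finite_length : C -> Prop :=
| finite_length_zero X : is_zero X -> finite_length X
| finite_length_ext Y X S (i : mor Y X) (p : mor X S) :
    finite_length Y -> is_simple S -> is_kernel i p -> is_cokernel p i ->
    finite_length X.

End Abelian.

Record monoidalCategory (k : fieldType) := MonoidalCategory {
  mcat :> linearCategory k;
  tens : mcat -> mcat -> mcat;
  tensm : forall X X' Y Y' : mcat,
    mor X X' -> mor Y Y' -> mor (tens X Y) (tens X' Y');
  tunit : mcat;
  tensm_linear_r : forall (X X' Y Y' : mcat) (f : mor X X'),
    linear (@tensm X X' Y Y' f);
  tensm_linear_l : forall (X X' Y Y' : mcat) (g : mor Y Y'),
    linear ((@tensm X X' Y Y')^~ g);
  tensm1 : forall X Y : mcat, tensm (idm X) (idm Y) = idm (tens X Y);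
  tensm_comp : forall (X X' X'' Y Y' Y'' : mcat)
    (f' : mor X' X'') (f : mor X X') (g' : mor Y' Y'') (g : mor Y Y'),
    tensm (f' ∘ f) (g' ∘ g) = tensm f' g' ∘ tensm f g;
  assoc : forall X Y Z, mor (tens (tens X Y) Z) (tens X (tens Y Z));
  associ : forall X Y Z, mor (tens X (tens Y Z)) (tens (tens X Y) Z);
  lunit : forall X, mor (tens tunit X) X;
  luniti : forall X, mor X (tens tunit X);
  runit : forall X, mor (tens X tunit) X;
  runiti : forall X, mor X (tens X tunit);
  assocK : forall X Y Z, associ X Y Z ∘ assoc X Y Z = idm _;
  associK : forall X Y Z, assoc X Y Z ∘ associ X Y Z = idm _;
  lunitK : forall X, luniti X ∘ lunit X = idm _;
  lunitiK : forall X, lunit X ∘ luniti X = idm _;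
  runitK : forall X, runiti X ∘ runit X = idm _;
  runitiK : forall X, runit X ∘ runiti X = idm _;
  assoc_nat : forall (X X' Y Y' Z Z' : mcat)
    (f : mor X X') (g : mor Y Y') (h : mor Z Z'),
    assoc X' Y' Z' ∘ tensm (tensm f g) h
    = tensm f (tensm g h) ∘ assoc X Y Z;
  lunit_nat : forall (X Y : mcat) (f : mor X Y),
    lunit Y ∘ tensm (idm tunit) f = f ∘ lunit X;
  runit_nat : forall (X Y : mcat) (f : mor X Y),
    runit Y ∘ tensm f (idm tunit) = f ∘ runit X;
  pentagon : forall W X Y Z,
    tensm (idm W) (assoc X Y Z) ∘ assoc W (tens X Y) Z
      ∘ tensm (assoc W X Y) (idm Z)
    = assoc W X (tens Y Z) ∘ assoc (tens W X) Y Z;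
  triangle : forall X Y,
    tensm (idm X) (lunit Y) ∘ assoc X tunit Y = tensm (runit X) (idm Y)
}.

Arguments tens {k m} X Y.
Arguments tensm {k m X X' Y Y'} f g.
Arguments tunit {k m}.
Arguments assoc {k m} X Y Z.
Arguments associ {k m} X Y Z.
Arguments lunit {k m} X.
Arguments luniti {k m} X.
Arguments runit {k m} X.
Arguments runiti {k m} X.

Notation "X ⊗ Y" := (tens X Y)
  (at level 38, left associativity) : cat_scope.
Notation "f ⊗m g" := (tensm f g)
  (at level 38, left associativity) : cat_scope.
Notation "𝟙" := tunit : cat_scope.

Section Duals.
Variables (k : fieldType) (M : monoidalCategory k).

Definition is_left_dual (X D : M) (ev : mor (D ⊗ X) 𝟙) (coev : mor 𝟙 (X ⊗ D))
    : Prop :=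
  runit X ∘ (idm X ⊗m ev) ∘ assoc X D X ∘ (coev ⊗m idm X) ∘ luniti X = idm X
  /\
  lunit D ∘ (ev ⊗m idm D) ∘ associ D X D ∘ (idm D ⊗m coev) ∘ runiti D = idm D.

(* A right dual of X is an object of which X is a left dual. *)
Definition has_right_dual (X : M) : Prop :=
  exists (D : M) (ev : mor (X ⊗ D) 𝟙) (coev : mor 𝟙 (D ⊗ X)),
    is_left_dual ev coev.

(* When D is a left dual of A with coevaluation c, this is the morphism E -> D
   corresponding to e under Hom (E ⊗ A, 1) ≅ Hom (E, D). *)
Definition transpose (E A D : M) (c : mor 𝟙 (A ⊗ D)) (e : mor (E ⊗ A) 𝟙)
    : mor E D :=
  lunit D ∘ (e ⊗m idm D) ∘ associ E A D ∘ (idm E ⊗m c) ∘ runiti E.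

End Duals.

Record rigidCategory (k : fieldType) := RigidCategory {
  rcat :> monoidalCategory k;
  ldual : rcat -> rcat;
  ev : forall X, mor (ldual X ⊗ X) 𝟙;
  coev : forall X, mor 𝟙 (X ⊗ ldual X);
  dualP : forall X, is_left_dual (ev X) (coev X);
  right_dualP : forall X : rcat, has_right_dual X
}.

Arguments ldual {k r} X.
Arguments ev {k r} X.
Arguments coev {k r} X.

Notation "X ^∨" := (ldual X) (at level 2, format "X ^∨") : cat_scope.

Section DoubleDual.
Variables (k : fieldType) (C : rigidCategory k).
Implicit Types X Y : C.

Definition dualm X Y (f : mor X Y) : mor Y^∨ X^∨ :=
  transpose (coev X) (ev Y ∘ (idm Y^∨ ⊗m f)).

Definition ddualm X Y (f : mor X Y) : mor X^∨^∨ Y^∨^∨ := dualm (dualm f).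

(* [ev_tens] and [coev_tens] exhibit Y^∨ ⊗ X^∨ as a left dual of X ⊗ Y. *)
Definition ev_tens X Y : mor ((Y^∨ ⊗ X^∨) ⊗ (X ⊗ Y)) 𝟙 :=
  ev Y ∘ (idm Y^∨ ⊗m lunit Y) ∘ (idm Y^∨ ⊗m (ev X ⊗m idm Y))
    ∘ (idm Y^∨ ⊗m associ X^∨ X Y) ∘ assoc Y^∨ X^∨ (X ⊗ Y).

Definition coev_tens X Y : mor 𝟙 ((X ⊗ Y) ⊗ (Y^∨ ⊗ X^∨)) :=
  associ X Y (Y^∨ ⊗ X^∨) ∘ (idm X ⊗m assoc Y Y^∨ X^∨)
    ∘ (idm X ⊗m (coev Y ⊗m idm X^∨)) ∘ (idm X ⊗m luniti X^∨) ∘ coev X.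

(* Mutually inverse canonical isomorphisms Y^∨ ⊗ X^∨ ≅ (X ⊗ Y)^∨. *)
Definition dual_tens X Y : mor (Y^∨ ⊗ X^∨) (X ⊗ Y)^∨ :=
  transpose (coev (X ⊗ Y)) (ev_tens X Y).
Definition dual_tensi X Y : mor (X ⊗ Y)^∨ (Y^∨ ⊗ X^∨) :=
  transpose (coev_tens X Y) (ev (X ⊗ Y)).

(* Mutually inverse canonical isomorphisms 1 ≅ 1^∨. *)
Definition dual_unit : mor 𝟙 (𝟙^∨ : C) :=
  transpose (coev 𝟙) (lunit 𝟙).
Definition dual_uniti : mor (𝟙^∨ : C) 𝟙 := ev 𝟙 ∘ runiti 𝟙^∨.

(* The monoidal structure of the functor X |-> X^∨^∨. *)
Definition ddual_tens X Y : mor (X^∨^∨ ⊗ Y^∨^∨) (X ⊗ Y)^∨^∨ :=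
  dualm (dual_tensi X Y) ∘ dual_tens Y^∨ X^∨.
Definition ddual_unit : mor 𝟙 (𝟙^∨^∨ : C) := dualm dual_uniti ∘ dual_unit.

End DoubleDual.

Record tensorCategory (k : fieldType) := TensorCategory {
  tcat :> rigidCategory k;
  tcat_abelian : is_abelian tcat;
  tcat_finite_length : forall X : tcat, finite_length X;
  tcat_unit_simple : is_simple (𝟙 : tcat)
}.

Record pivotalStructure (k : fieldType) (C : rigidCategory k) :=
  PivotalStructure {
  piv :> forall X : C, mor X X^∨^∨;
  piv_iso : forall X, is_iso (piv X);
  piv_nat : forall (X Y : C) (f : mor X Y), piv Y ∘ f = ddualm f ∘ piv X;
  piv_tens : forall X Y : C,
    piv (X ⊗ Y) = ddual_tens X Y ∘ (piv X ⊗m piv Y);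
  piv_unit : piv 𝟙 = ddual_unit C
}.

Section Trace.
Variables (k : fieldType) (C : rigidCategory k) (δ : pivotalStructure C).

Definition pivotal_ev (X : C) : mor (X ⊗ X^∨) 𝟙 :=
  ev X^∨ ∘ (δ X ⊗m idm X^∨).

Definition right_trace (X : C) (f : mor X X) : mor (𝟙 : C) 𝟙 :=
  pivotal_ev X ∘ (f ⊗m idm X^∨) ∘ coev X.

End Trace.

(* A full subcategory is given by the predicate selecting its objects. *)
Record right_tensor_ideal (k : fieldType) (C : monoidalCategory k)
    (I : C -> Prop) : Prop := RightTensorIdeal {
  ideal_tens : forall X V : C, I X -> I (X ⊗ V);
  ideal_retract : forall X Y S Z : C,
    I Z -> is_direct_sum X Y S -> isomorphic Z S -> I X /\ I Y
}.

Definition proper_subcategory (k : fieldType) (C : linearCategory k)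
    (I : C -> Prop) : Prop := ~ (forall X : C, I X).

(* Main.v *)
Require Import Defs.
From mathcomp Require Import all_boot all_order all_algebra.
Local Open Scope ring_scope.
Local Open Scope cat_scope.

(** If tr(f) were nonzero, it would be invertible, because 𝟙 is simple. Hence
    𝟙 would be a retract of X ⊗ X^∨, which lies in I; then every
    V ≅ 𝟙 ⊗ V would lie in I, contradicting properness. *)

Import GRing.Theory.

Section Composition.
Local Set Implicit Arguments.
Local Unset Strict Implicit.
Variables (k : fieldType) (C : linearCategory k).
Implicit Types X Y Z : C.

Lemma compmBr X Y Z (g : mor Y Z) (f f' : mor X Y) :
  g ∘ (f - f') = g ∘ f - g ∘ f'.
Proof.
(* At the scalar -1, linearity speaks of [-1 *: f' + f], which is [f - f']. *)
have := @comp_linear_r _ _ _ _ _ g (-1) f' f.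
by rewrite !scaleN1r ![- _ + _]addrC.
Qed.

Lemma compmBl X Y Z (g g' : mor Y Z) (f : mor X Y) :
  (g - g') ∘ f = g ∘ f - g' ∘ f.
Proof.
have := @comp_linear_l _ _ _ _ _ f (-1) g' g.
by rewrite /= !scaleN1r ![- _ + _]addrC.
Qed.

Lemma compm0 X Y Z (g : mor Y Z) : g ∘ (0 : mor X Y) = 0.
Proof. by rewrite -(subrr 0) compmBr subrr. Qed.

Lemma comp0m X Y Z (f : mor X Y) : (0 : mor Y Z) ∘ f = 0.
Proof. by rewrite -(subrr 0) compmBl subrr. Qed.

Lemma kernel_mono K X Y (i : mor K X) (f : mor X Y) :
  is_kernel i f -> is_mono i.
Proof.
move=> [fi0 univ] W g h eq_gh.
have [|u [_ uniq_u]] := univ W (i ∘ g); first by rewrite Defs.compA fi0 comp0m.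
by rewrite -(uniq_u g (erefl _)) -(uniq_u h (esym eq_gh)).
Qed.

(** Schur's argument on the kernel of [t], a subobject of [X]: if it is zero, [t] is mono and is
    thus itself a subobject of the nonzero simple [X]; if it is all of [X], then [t = 0]. *)
Lemma simple_endo_iso (X : C) (t : mor X X) :
  is_abelian C -> is_simple X -> t != 0 -> is_iso t.
Proof.
move=> abC [nzX simpleX] nz_t.
have [K [i ker_i]] := abelian_ker abC t.
have [zK | [j [_ ij1]]] := simpleX K i (kernel_mono ker_i).
- have mono_t : is_mono t.
    move=> W g h eq_gh; apply/eqP; rewrite -subr_eq0; apply/eqP.
    (* [t] kills [g - h], which therefore factors through the zero object [K]. *)
    have [|u [<- _]] := ker_i.2 W (g - h).
      by rewrite compmBr eq_gh subrr.
    by rewrite (zK.2 W u) compm0.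
  by case: (simpleX X t mono_t).
- case/eqP: nz_t.
  by rewrite -(compm1 t) -ij1 Defs.compA ker_i.1 comp0m.
Qed.

(** The complement is the kernel of [b]: the idempotent [idm S - a ∘ b] is killed by [b], so it
    factors through that kernel, and the factor [q] is the second projection. *)
Lemma retract_direct_sum (X S : C) (a : mor X S) (b : mor S X) :
  is_abelian C -> b ∘ a = idm X -> exists Y, is_direct_sum X Y S.
Proof.
move=> abC ba1.
have [Y [i ker_i]] := abelian_ker abC b.
have mono_i := kernel_mono ker_i.
have bi0 := ker_i.1.
have [|q [iq _]] := ker_i.2 S (idm S - a ∘ b).
  by rewrite compmBr compm1 Defs.compA ba1 comp1m subrr.
exists Y, a, i, b, q; split => //.
(* The values of [q ∘ i] and [q ∘ a] are read off after composing with the mono [i], where [i ∘ q]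
   is known. *)
- by apply: mono_i; rewrite Defs.compA iq compmBl comp1m compm1 -Defs.compA bi0 compm0 subr0.
- by apply: mono_i; rewrite Defs.compA iq compmBl comp1m -Defs.compA ba1 compm1 subrr compm0.
- by rewrite iq addrC subrK.
Qed.

End Composition.

Section Ideal.
Local Set Implicit Arguments.
Local Unset Strict Implicit.
Variables (k : fieldType) (C : monoidalCategory k) (I : C -> Prop).
Hypotheses (abC : is_abelian C) (hI : right_tensor_ideal I).

(** Turns closure under direct summands into a criterion that needs only a section and a
    retraction. *)
Lemma right_tensor_ideal_retract (X S : C) (a : mor X S) (b : mor S X) :
  b ∘ a = idm X -> I S -> I X.
Proof.
move=> ba1 IS; have [Y sumS] := retract_direct_sum abC ba1.
apply: proj1 (ideal_retract hI IS sumS _).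
by exists (idm S), (idm S); rewrite comp1m.
Qed.

Lemma right_tensor_ideal_unit (V : C) : I 𝟙 -> I V.
Proof.
move=> I1.
exact: right_tensor_ideal_retract (lunitiK V) (ideal_tens hI V I1).
Qed.

End Ideal.

Theorem lemma2p6 (k : closedFieldType) (C : tensorCategory k)
    (δ : pivotalStructure C) (I : C -> Prop)
    (hI : right_tensor_ideal I) (hproper : proper_subcategory I)
    (X : C) (hX : I X) (f : mor X X) :
  right_trace δ f = 0.
Proof.
have abC := tcat_abelian C.
case: (eqVneq (right_trace δ f) 0) => // nz_t; case: hproper => V.
have [g [gt1 _]] := simple_endo_iso abC (tcat_unit_simple C) nz_t.
(* Reassociating [g ∘ right_trace δ f = idm 𝟙] makes [coev X] a section of 𝟙 into [X ⊗ X^∨], with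
   all other factors forming the retraction. *)
have retr1 : (g ∘ (pivotal_ev δ X ∘ (f ⊗m idm X^∨))) ∘ coev X = idm 𝟙.
  by rewrite -Defs.compA.
apply: (right_tensor_ideal_unit abC hI V).
exact: (right_tensor_ideal_retract abC hI retr1 (ideal_tens hI X^∨ hX)).
Qed.
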